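(* Let $G=A\rtimes(\langle\tau_1\rangle\times\cdots\times\langle\tau_r\rangle)$, $n_s$, $\psi_s$, $m_s$, $\epsilon_s$, $y_s$ $(1\le s\le r)$ be as in the context. Suppose that $A$ has finite exponent coprime to $p_1,\dots,p_r$, that $A$ is abelian, and that $\psi_1,\dots,\psi_r$ lie in the center of $\mathrm{Aut}(A)$. If $n_s-m_s+\epsilon_s\le y_s\le m_s$ for all $1\le s\le r$, then all of the following hold: (2) $\psi_s$ has order dividing $p_s^{m_s}$ for all $1\le s\le r$; (3) $\theta_s\equiv 1\pmod{p_s^{n_s-m_s+\epsilon_s}}$ for all $\theta\in\mathrm{Aut}(G)$ and all $1\le s\le r$, where $\theta(\tau_s)=c_s\tau_s^{\theta_s}$ with $c_s\in A$ and $\theta_s\in\mathbb{Z}$; (4) $n_s\le 2m_s-\epsilon_s$ for all $1\le s\le r$.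
   Context: $\mathbb{N}$ denotes the positive integers. $A$ is a group, $d=p_1^{n_1}\cdots p_r^{n_r}$ with $p_1,\dots,p_r$ distinct primes and $n_1,\dots,n_r\in\mathbb{N}$, and $G=A\rtimes C_d$ with $C_d$ cyclic of order $d$, written as $G=A\rtimes(\langle\tau_1\rangle\times\cdots\times\langle\tau_r\rangle)$, where $\tau_s$ has order $p_s^{n_s}$. For $1\le s\le r$, $\psi_s\in\mathrm{Aut}(A)$ is the automorphism with $\tau_s a\tau_s^{-1}=\psi_s(a)$ for all $a\in A$; its order divides $p_s^{n_s}$, and $0\le y_s\le n_s$ is the integer such that $\psi_s$ has order $p_s^{y_s}$. For each $s$, $m_s\in\mathbb{N}$ is fixed with $m_s\le n_s$, and with $m_s\ge 2$ if $p_s=2$. Put $\epsilon_s=1$ if $p_s=2$ and $\epsilon_s=0$ if $p_s$ is odd. When $A$ has finite exponent coprime to $p_1,\dots,p_r$, every $\theta\in\mathrm{Aut}(G)$ satisfies $\theta(\tau_s)=c_s\tau_s^{\theta_s}$ for some $c_s\in A$ and $\theta_s\in\mathbb{Z}$, with $\theta_s$ determined modulo $p_s^{n_s}$. *)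

(* Defs.v *)
From HB Require Import structures.
From mathcomp Require Import all_boot all_algebra.
From mathcomp Require Import boolp.

Set Implicit Arguments.
Unset Strict Implicit.
Unset Printing Implicit Defensive.

Local Open Scope group_scope.

(* The inverse function is stored as data so that inversion in Aut(G) needs no
   choice; it is determined by [aut_fun], see [autoP]. *)
Record auto (G : groupType) := Auto {
  aut_fun :> G -> G;
  aut_inv : G -> G;
  aut_funM : {morph aut_fun : x y / x * y};
  aut_funK : cancel aut_fun aut_inv;
  aut_invK : cancel aut_inv aut_fun
}.

Lemma autoP (G : groupType) (f g : auto G) : f =1 g -> f = g.
Proof.
case: f g => [f f' fM fK f'K] [g g' gM gK g'K] /= eq_fg.
have Dfg : f = g by apply: funext.
subst g.
have Dfg' : f' = g' by apply: funext => x; rewrite -{1}(g'K x) fK.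
by subst g'; congr Auto; apply: Prop_irrelevance.
Qed.

HB.instance Definition _ (G : groupType) := gen_eqMixin (auto G).
HB.instance Definition _ (G : groupType) := gen_choiceMixin (auto G).

Definition aut_one (G : groupType) : auto G :=
  @Auto G id id (fun _ _ => erefl) (fun _ => erefl) (fun _ => erefl).

Lemma aut_mul_subproof (G : groupType) (f g : auto G) :
  {morph (f \o g : G -> G) : x y / x * y}.
Proof. by move=> x y; rewrite /= !aut_funM. Qed.

Definition aut_mul (G : groupType) (f g : auto G) : auto G :=
  Auto (aut_mul_subproof f g) (can_comp (@aut_funK G f) (@aut_funK G g))
    (can_comp (@aut_invK G g) (@aut_invK G f)).

Lemma aut_invg_subproof (G : groupType) (f : auto G) :
  {morph aut_inv f : x y / x * y}.
Proof.
by move=> x y; apply: (can_inj (@aut_funK G f)); rewrite aut_funM !aut_invK.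
Qed.

Definition aut_invg (G : groupType) (f : auto G) : auto G :=
  Auto (aut_invg_subproof f) (@aut_invK G f) (@aut_funK G f).

Lemma aut_mulA (G : groupType) : associative (@aut_mul G).
Proof. by move=> f g h; apply: autoP. Qed.

Lemma aut_mul1 (G : groupType) : left_id (@aut_one G) (@aut_mul G).
Proof. by move=> f; apply: autoP. Qed.

Lemma aut_mulr1 (G : groupType) : right_id (@aut_one G) (@aut_mul G).
Proof. by move=> f; apply: autoP. Qed.

Lemma aut_mulV (G : groupType) :
  left_inverse (@aut_one G) (@aut_invg G) (@aut_mul G).
Proof. by move=> f; apply: autoP => x; apply: aut_funK. Qed.

Lemma aut_mulrV (G : groupType) :
  right_inverse (@aut_one G) (@aut_invg G) (@aut_mul G).
Proof. by move=> f; apply: autoP => x; apply: aut_invK. Qed.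

HB.instance Definition _ (G : groupType) :=
  isGroup.Build (auto G) (@aut_mulA G) (@aut_mul1 G) (@aut_mulr1 G)
    (@aut_mulV G) (@aut_mulrV G).

Definition in_center (G : groupType) (x : G) : Prop :=
  forall y : G, commute x y.

Definition has_order (G : groupType) (x : G) (k : nat) : Prop :=
  [/\ (0 < k)%N, x ^+ k = 1
    & forall j, (0 < j)%N -> x ^+ j = 1 -> (k <= j)%N].

Definition has_exponent (G : groupType) (e : nat) : Prop :=
  [/\ (0 < e)%N, forall x : G, x ^+ e = 1
    & forall j, (0 < j)%N -> (forall x : G, x ^+ j = 1) -> (e <= j)%N].

Definition expgz (G : groupType) (x : G) (k : int) : G :=
  match k with Posz j => x ^+ j | Negz j => x ^- j.+1 end.

(* G is the internal semidirect product of the normal subgroup iota(A) and the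
   internal direct product <tau_1> x ... x <tau_r>, where tau_s has order q_s.
   As the tau_s commute and have finite order, the products of natural powers
   of the tau_s are exactly the elements of the subgroup they generate. *)
Record is_semidirect (A G : groupType) (iota : {multiplicative A -> G})
    (r : nat) (tau : 'I_r -> G) (q : 'I_r -> nat) : Prop := IsSemidirect {
  sd_inj : injective iota;
  sd_normal : forall (g : G) (a : A),
    exists b : A, g * iota a * g^-1 = iota b;
  sd_order : forall s, has_order (tau s) (q s);
  sd_commute : forall s t, commute (tau s) (tau t);
  sd_direct : forall k : 'I_r -> nat,
    \prod_(s < r) tau s ^+ k s = 1 -> forall s, tau s ^+ k s = 1;
  sd_disjoint : forall (a : A) (k : 'I_r -> nat),
    iota a = \prod_(s < r) tau s ^+ k s -> iota a = 1;
  sd_full : forall g : G, exists (a : A) (k : 'I_r -> nat),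
    g = iota a * \prod_(s < r) tau s ^+ k s
}.

Definition eps (p : nat) : nat := (p == 2)%N.

(* Main.v *)
(** As [e] is coprime to every [p s], the subgroup [A] consists of the elements
    of [G] killed by [e], so it is characteristic and [theta] restricts to an
    automorphism [alpha] of [A].  Since [A] is abelian, applying [theta] to
    [tau_s a tau_s^-1 = psi_s(a)] gives [alpha psi_s = psi_s^k alpha] when
    [theta(tau_s) = c tau_s^k].  Centrality of [psi_s] then yields
    [psi_s^k = psi_s], i.e. [k = 1] modulo the order [p_s^y_s] of [psi_s], and
    [n_s - m_s + eps_s <= y_s]. *)

Require Import Defs.
From mathcomp Require Import all_boot all_algebra.
From mathcomp Require Import zify ring.
From mathcomp Require boolp.

Lemma morph_mulg1 {G H : groupType} {f : G -> H} :
  {morph f : x y / (x * y)%g} -> f 1%g = 1%g.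
Proof. by move=> fM; apply: (mulgI (f 1%g)); rewrite -fM !mulg1. Qed.

Lemma morph_mulgV {G H : groupType} {f : G -> H} :
  {morph f : x y / (x * y)%g} -> {morph f : x / x^-1%g}.
Proof.
move=> fM x; apply: (mulgI (f x)).
by rewrite -fM !mulgV (morph_mulg1 fM).
Qed.

Lemma morph_mulgX {G H : groupType} {f : G -> H} :
  {morph f : x y / (x * y)%g} -> forall n, {morph f : x / (x ^+ n)%g}.
Proof.
move=> fM n x; elim: n => [|n IHn]; first exact: morph_mulg1.
by rewrite !expgS fM IHn.
Qed.

Lemma has_order_dvdn (G : groupType) (x : G) (k j : nat) :
  has_order x k -> (x ^+ j = 1)%g -> k %| j.
Proof.
move=> [k_gt0 xk min_k] xj.
case: (posnP (j %% k)) => [/eqP // | /min_k min_mod].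
suff /min_mod : (x ^+ (j %% k) = 1)%g by rewrite leqNgt ltn_pmod.
by rewrite -xj {2}(divn_eq j k) expgnDr mulnC expgnA xk expg1n mul1g.
Qed.

Lemma expgz_eq_expg (G : groupType) (x : G) (q : nat) (k : int) :
  has_order x q ->
  exists2 j : nat, expgz x k = (x ^+ j)%g & (k = j %[mod q])%Z.
Proof.
case=> q_gt0 xq _; case: k => j; first by exists j.
(* Here [k] is [-j.+1]; since [x^-1 = x ^+ q.-1], adding [j.+1 * q] gives a natural exponent. *)
exists (j.+1 * q.-1)%N => /=.
  apply: mulg1_eq; rewrite -expgnDr -mulnS prednK //.
  by rewrite mulnC expgnA xq expg1n.
apply/eqP; rewrite eqz_mod_dvd NegzE -GRing.opprD -PoszD dvdzE abszN.
by rewrite -mulnS prednK // dvdn_mull.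
Qed.

Lemma expg_eq_id (G : groupType) (x : G) (q j : nat) :
  has_order x q -> (x ^+ j = x)%g -> (j = 1 %[mod q])%Z.
Proof.
move=> xq xj; have [q_gt0 xq1 _] := xq.
(* Multiplying by [x ^+ q.-1] stands in for dividing by [x]: natural subtraction in [j - 1] would
   truncate at [j = 0]. *)
have: q %| j + q.-1.
  by apply: (has_order_dvdn _ _ _ _ xq); rewrite expgnDr xj -expgS prednK.
case/dvdnP=> u Eu; apply/eqP; rewrite eqz_mod_dvd; apply/dvdzP.
exists (u%:Z - 1)%R; rewrite GRing.mulrBl GRing.mul1r -PoszM -Eu.
by rewrite PoszD -[in X in _ = (_ - X)%R](prednK q_gt0) intS; ring.
Qed.

Lemma prodgX_commute (G : monoidType) (r : nat) (F : 'I_r -> G) (j : nat) :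
  (forall s t, commute (F s) (F t)) ->
  ((\prod_(s < r) F s) ^+ j = \prod_(s < r) F s ^+ j)%g.
Proof.
move=> cF; elim: j => [|j IHj]; first by rewrite expg0 big1.
rewrite expgS IHj -prodgM_commute; last by move=> s t _ _; apply: commuteX.
by apply: eq_bigr => s _; rewrite expgS.
Qed.

(** Powers are computed modulo the normal subgroup [A], where only the commuting [tau s] remain;
    normality collects all factors from [A] on the left. *)
Lemma is_semidirect_expg {A G : groupType} {iota : {multiplicative A -> G}}
    {r : nat} {tau : 'I_r -> G} {q : 'I_r -> nat} :
  is_semidirect iota tau q ->
  forall (a : A) (k : 'I_r -> nat) (j : nat), exists b : A,
    ((iota a * \prod_(s < r) tau s ^+ k s) ^+ j
      = iota b * \prod_(s < r) tau s ^+ (k s * j))%g.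
Proof.
move=> sd a k j; set c := (\prod_(s < r) tau s ^+ k s)%g.
have -> : (\prod_(s < r) tau s ^+ (k s * j) = c ^+ j)%g.
  rewrite prodgX_commute => [|s t]; last by apply: commuteX2; apply: (sd_commute sd).
  by apply: eq_bigr => s _; rewrite expgnA.
elim: j => [|j [b IHj]]; first by exists 1%g; rewrite (morph_mulg1 gmulfM) mul1g.
have [b' Eb'] := sd_normal sd c b.
exists (a * b')%g; rewrite expgS IHj gmulfM -Eb' expgS -!mulgA.
by rewrite mulKg.
Qed.

(** The [tau]-part of the power lies in [A], hence is trivial by disjointness; directness then kills
    each factor separately. *)
Lemma is_semidirect_expg_eq1 {A G : groupType} {iota : {multiplicative A -> G}}
    {r : nat} {tau : 'I_r -> G} {q : 'I_r -> nat} :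
  is_semidirect iota tau q ->
  forall (a : A) (k : 'I_r -> nat) (j : nat),
    ((iota a * \prod_(s < r) tau s ^+ k s) ^+ j = 1)%g ->
  forall s, q s %| k s * j.
Proof.
move=> sd a k j; have [b ->] := is_semidirect_expg sd a k j => bc1 s.
apply: has_order_dvdn (sd_order sd s) _; move: s.
apply: (sd_direct sd).
have Eb : iota (b^-1)%g = (\prod_(s < r) tau s ^+ (k s * j))%g.
  by rewrite (morph_mulgV gmulfM); apply: mulg1_eq.
by rewrite -Eb; apply: (sd_disjoint sd) Eb.
Qed.

(** Each [q s] divides [k s * e], hence [k s] by coprimality, so the whole [tau]-part of [g]
    vanishes. *)
Lemma is_semidirect_torsion {A G : groupType} {iota : {multiplicative A -> G}}
    {r : nat} {tau : 'I_r -> G} {q : 'I_r -> nat} {e : nat} :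
  is_semidirect iota tau q -> (forall s, coprime e (q s)) ->
  forall g : G, (g ^+ e = 1)%g -> exists a : A, g = iota a.
Proof.
move=> sd co_e g; have [a [k ->]] := sd_full sd g => ge1; exists a.
rewrite big1 ?mulg1 // => s _.
have := is_semidirect_expg_eq1 sd _ _ _ ge1 s.
rewrite Gauss_dvdl; last by rewrite coprime_sym.
case/dvdnP=> u ->; have [_ tauq _] := sd_order sd s.
by rewrite mulnC expgnA tauq expg1n.
Qed.

Lemma auto_restrict {A G : groupType} {iota : {multiplicative A -> G}} :
  injective iota ->
  (forall (theta : auto G) (a : A), exists b, theta (iota a) = iota b) ->
  forall theta : auto G,
  exists alpha : auto A, forall a, theta (iota a) = iota (alpha a).
Proof.
move=> iotaI charA theta.
have [f Ef] := boolp.choice (charA theta).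
(* Stability of [A] under [theta^-1] as well supplies the inverse of the restriction. *)
have [f' Ef'] := boolp.choice (charA theta^-1%g).
have fM : {morph f : x y / (x * y)%g}.
  by move=> a b; apply: iotaI; rewrite -Ef !gmulfM aut_funM !Ef.
have fK : cancel f f'.
  by move=> a; apply: iotaI; rewrite -Ef' -Ef; apply: aut_funK.
have f'K : cancel f' f.
  by move=> a; apply: iotaI; rewrite -Ef -Ef'; apply: aut_invK.
by exists (Auto fM fK f'K).
Qed.

Lemma auto_conjX (A G : groupType) (iota : {multiplicative A -> G})
    (t : G) (f : auto A) :
  (forall a, t * iota a * t^-1 = iota (f a))%g ->
  forall j a, (t ^+ j * iota a * t ^- j = iota ((f ^+ j) a))%g.
Proof.
move=> tE; elim=> [|j IHj] a; first by rewrite mul1g invg1 mulg1.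
by rewrite !expgS invgM -[RHS]tE -IHj !mulgA.
Qed.

(* The component of [theta(tau_s)] along [tau_t], [t != s], is killed by both
   [q s] and [q t]. *)
Lemma auto_semidirect_tau {A G : groupType} {iota : {multiplicative A -> G}}
    {r : nat} {tau : 'I_r -> G} {q : 'I_r -> nat} :
  is_semidirect iota tau q -> (forall s t, s != t -> coprime (q s) (q t)) ->
  forall (theta : auto G) s, exists (c : A) (k : nat),
    theta (tau s) = (iota c * tau s ^+ k)%g.
Proof.
move=> sd co_q theta s; have [a [k Ek]] := sd_full sd (theta (tau s)).
exists a, (k s); rewrite Ek; congr (_ * _)%g.
have tau_q : (theta (tau s) ^+ q s = 1)%g.
  have [_ tauq _] := sd_order sd s.
  rewrite -(morph_mulgX (aut_funM theta)) tauq.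
  exact: morph_mulg1 (aut_funM theta).
rewrite Ek in tau_q.
have tau_t t : t != s -> (tau t ^+ k t = 1)%g.
  move=> ts; have := is_semidirect_expg_eq1 sd _ _ _ tau_q t.
  rewrite Gauss_dvdl ?co_q //; case/dvdnP=> u ->.
  by have [_ tauq _] := sd_order sd t; rewrite mulnC expgnA tauq expg1n.
transitivity (\prod_(t < r | t == s) tau t ^+ k t)%g; last by rewrite big_pred1_eq.
rewrite [RHS]big_mkcond; apply: eq_bigr => t _.
by case: eqP => // /eqP/tau_t.
Qed.

Theorem corollary4p2 (A G : groupType) (iota : {multiplicative A -> G})
    (r : nat) (p n m y : 'I_r -> nat) (tau : 'I_r -> G) (psi : 'I_r -> auto A)
    (e : nat)
    (p_prime : forall s, prime (p s))
    (p_inj : injective p)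
    (n_gt0 : forall s, 0 < n s)
    (G_sd : is_semidirect iota tau (fun s => p s ^ n s))
    (psiE : forall s (a : A),
      (tau s * iota a * (tau s)^-1 = iota (psi s a))%g)
    (y_le_n : forall s, y s <= n s)
    (psi_order : forall s, has_order (psi s) (p s ^ y s))
    (m_gt0 : forall s, 0 < m s)
    (m_le_n : forall s, m s <= n s)
    (m_ge2 : forall s, p s = 2 -> 2 <= m s)
    (A_exp : has_exponent A e)
    (e_coprime : forall s, coprime e (p s))
    (A_abelian : forall a b : A, commute a b)
    (psi_center : forall s, in_center (psi s))
    (y_bounds : forall s, n s - m s + eps (p s) <= y s <= m s) :
  [/\ forall s, exists2 k, has_order (psi s) k & k %| p s ^ m s,
      forall (theta : auto G) s,
        (exists (c : A) (k : int),
           theta (tau s) = (iota c * expgz (tau s) k)%g) /\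
        (forall (c : A) (k : int),
           theta (tau s) = (iota c * expgz (tau s) k)%g ->
           (k = 1 %[mod (p s ^ (n s - m s + eps (p s)))%N])%Z)
    & forall s, n s <= 2 * m s - eps (p s)].
Proof.
have co_q s t : s != t -> coprime (p s ^ n s) (p t ^ n t).
  move=> st; apply/coprimeXl/coprimeXr.
  by rewrite prime_coprime // dvdn_prime2 // (inj_eq p_inj).
have co_e s : coprime e (p s ^ n s) by apply: coprimeXr.
(* [theta (iota a)] is still killed by [e], which is coprime to the orders of all [tau s]. *)
have charA (theta : auto G) a : exists b, theta (iota a) = iota b.
  apply: (is_semidirect_torsion G_sd co_e).
  have [_ expA _] := A_exp.
  by rewrite -(morph_mulgX (aut_funM theta)) -(morph_mulgX gmulfM) expA
    (morph_mulg1 gmulfM) (morph_mulg1 (aut_funM theta)).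
split=> [s | theta s | s].
- exists (p s ^ y s)%N; first exact: psi_order.
  by have /andP[_ ym] := y_bounds s; apply: dvdn_exp2l.
- split=> [|c k Ek].
    by have [c [k Ek]] := auto_semidirect_tau G_sd co_q theta s; exists c, (Posz k).
  have [alpha Ealpha] := auto_restrict (sd_inj G_sd) charA theta.
  have [j Ej kj] := expgz_eq_expg _ _ _ k (sd_order G_sd s).
  rewrite Ej in Ek.
  have psiX : (psi s ^+ j = psi s)%g.
    (* By centrality it suffices that [psi s ^+ j * alpha = alpha * psi s], which is [theta] applied
       to the relation [psiE]. *)
    apply: (mulIg alpha); rewrite (psi_center s alpha).
    apply: autoP => a; apply: (sd_inj G_sd).
    transitivity (theta (tau s * iota a * (tau s)^-1)%g); last first.
      by rewrite psiE Ealpha.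
    rewrite !aut_funM (morph_mulgV (aut_funM theta)) Ek Ealpha invgM.
    (* Regrouping exposes the conjugation by [tau s ^+ j], which acts on [A] as [psi s ^+ j]; the
       outer conjugation by [c] is trivial because [A] is abelian. *)
    rewrite -!mulgA (mulgA (tau s ^+ j)%g) (mulgA _ _ (iota c)^-1)%g.
    rewrite (auto_conjX _ _ _ _ _ (psiE s)).
    by rewrite -(morph_mulgV gmulfM) -!gmulfM [(c * _)%g]A_abelian mulgVK.
  have dvd_qy : p s ^ (n s - m s + eps (p s)) %| p s ^ y s.
    by apply: dvdn_exp2l; have /andP[] := y_bounds s.
  have /dvdnP[u En] : p s ^ (n s - m s + eps (p s)) %| p s ^ n s.
    exact: dvdn_trans dvd_qy (dvdn_exp2l _ (y_le_n s)).
  have /dvdnP[v Ey] := dvd_qy.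
  (* The congruences [k = j] modulo [p s ^ n s] and [j = 1] modulo [p s ^ y s] both descend to the
     common divisor [p s ^ (n s - m s + eps (p s))], and [k - 1 = (k - j) + (j - 1)]. *)
  have := expg_eq_id _ _ _ _ (psi_order s) psiX.
  move/eqP: kj => kj /eqP j1; move: kj j1; rewrite !eqz_mod_dvd.
  rewrite En Ey !PoszM => /(dvdz_trans (dvdz_mull _ (dvdzz _))) kj.
  move=> /(dvdz_trans (dvdz_mull _ (dvdzz _))) j1.
  apply/eqP; rewrite eqz_mod_dvd.
  by rewrite -(GRing.subrKA j%:Z) GRing.rpredD.
(* Eliminating [y s] from its two bounds leaves [n s - m s + eps (p s) <= m s]. *)
- have /andP[nm ym] := y_bounds s.
  have {nm ym} := leq_trans nm ym; have := m_le_n s; lia.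
Qed.
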